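(* Let $n=2m\ge4$ be even and let $1\le m_0<m$. Let $\beta_0>0$ and $z_0,v\in\mathbb{R}$ with $(z_0,v)\ne(0,0)$, and consider the (unbounded) swirling/shear flow solution of the first-order geodesic system for $\mathsf{SL}(n)$ with initial data \[\beta(0)=\beta_0^{1/(2m_0)}I_{2m_0}\oplus\beta_0^{-1/(n-2m_0)}I_{n-2m_0},\qquad \zeta(0)=\Big(\bigoplus_{i=1}^{m_0}z_0Z_2\Big)\oplus0\,I_{n-2m_0},\] \[\omega(0)=\Big(\tfrac{1}{2m_0}v\,\beta_0^{-1/(2m_0)}I_{2m_0}\Big)\oplus\Big(-\tfrac{1}{n-2m_0}v\,\beta_0^{1/(n-2m_0)}I_{n-2m_0}\Big).\] Then this solution is dynamically unstable in the following sense: for every $\varepsilon>0$ there exist initial data $(\tilde\beta(0),\tilde\omega(0),\tilde\zeta(0))$ for the system (with $\tilde\beta(0)$ symmetric positive definite of determinant 1, $\tilde\omega(0)$ symmetric, $\tilde\zeta(0)$ antisymmetric and $\operatorname{tr}(\tilde\beta(0)\tilde\omega(0))=0$) within distance $\varepsilon$ of $(\beta(0),\omega(0),\zeta(0))$, such that the corresponding solution $(\tilde\beta,\tilde\omega,\tilde\zeta)$ is bounded (with $\tilde\beta^{-1}$ also bounded, so that the corresponding geodesic is bounded) and in fact periodic in time.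
   Context: The first-order geodesic system: for a geodesic $A(t)$ of $\mathsf{SL}(n)$ (with the Riemannian metric induced from the Hilbert-Schmidt inner product $\langle A,B\rangle=\operatorname{tr}(AB^T)$ on real $n\times n$ matrices), set $\beta=A^{-1}A^{-T}$, $\omega=A^TA'+(A^T)'A$, $\zeta=A^TA'-(A^T)'A$. Then $\beta$ is symmetric positive definite of determinant 1, $\omega$ is symmetric with $\operatorname{tr}(\beta\omega)=0$, $\zeta$ is antisymmetric, and \[\beta'=-\beta\omega\beta,\quad \zeta'=0,\quad \omega'=\tfrac12(\omega+\zeta)^T\beta(\omega+\zeta)+\tfrac12\frac{\operatorname{tr}\omega\beta\omega\beta}{\operatorname{tr}\beta}I+\tfrac12\frac{\operatorname{tr}\zeta\beta\zeta\beta}{\operatorname{tr}\beta}I.\] Here $I_k$ is the $k\times k$ identity, $Z_2=\begin{pmatrix}0&-1\\1&0\end{pmatrix}$, and $\oplus$ is the block-diagonal sum of matrices. Distance between data is measured in any norm on triples of matrices, e.g. the one from $|A|=\sqrt{\operatorname{tr}(AA^T)}$. *)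

(* Defs.v *)
From HB Require Import structures.
From mathcomp Require Import all_boot all_order all_algebra.
From mathcomp Require Import all_classical all_reals all_analysis.

Set Implicit Arguments.
Unset Strict Implicit.
Unset Printing Implicit Defensive.

Import Order.TTheory GRing.Theory Num.Theory.
Import numFieldNormedType.Exports.

Local Open Scope ring_scope.

Section GeodesicSystem.
Variables (R : realType) (n : nat).
Implicit Types (b w z : 'M[R]_n) (beta omega zeta : R -> 'M[R]_n).

Definition posdefmx b : Prop :=
  b^T = b /\ forall x : 'cV[R]_n, x != 0 -> 0 < (x^T *m b *m x) 0 0.

(* The phase space of the first-order system, as a set of triples
   (beta, omega, zeta). *)
Definition admissible b w z : Prop :=
  [/\ posdefmx b, \det b = 1, w^T = w, z^T = - z & \tr (b *m w) = 0].

Definition beta_rhs b w : 'M[R]_n := - (b *m w *m b).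

Definition omega_rhs b w z : 'M[R]_n :=
  2^-1 *: ((w + z)^T *m b *m (w + z))
  + (2^-1 * (\tr (w *m b *m w *m b) / \tr b))%:M
  + (2^-1 * (\tr (z *m b *m z *m b) / \tr b))%:M.

(* Solutions are defined for all times: the metric of SL(n), induced on a closed
   submanifold of Euclidean space, is geodesically complete. *)
Definition geodesic_solution beta omega zeta : Prop :=
  forall t : R,
    [/\ admissible (beta t) (omega t) (zeta t),
        is_derive t 1 beta (beta_rhs (beta t) (omega t)),
        is_derive t 1 omega (omega_rhs (beta t) (omega t) (zeta t))
      & is_derive t 1 zeta 0].

Definition hs_norm b : R := Num.sqrt (\tr (b *m b^T)).

Definition data_dist b w z b' w' z' : R :=
  hs_norm (b - b') + hs_norm (w - w') + hs_norm (z - z').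

Definition bounded_curve (f : R -> 'M[R]_n) : Prop :=
  exists M : R, forall t : R, hs_norm (f t) <= M.

Definition periodic_solution beta omega zeta : Prop :=
  exists2 T : R, 0 < T & forall t : R,
    [/\ beta (t + T) = beta t, omega (t + T) = omega t
      & zeta (t + T) = zeta t].

End GeodesicSystem.

Section InitialData.
Variable R : realType.

Definition Z2 : 'M[R]_2 := block_mx 0 (- 1%:M) 1%:M 0 : 'M[R]_(1 + 1).

(* a I_k (+) b I_(n - k), for k <= n. *)
Definition scalar_dsum (n k : nat) (a b : R) : 'M[R]_n :=
  diag_mx (\row_(i < n) if (i < k)%N then a else b).

(* (z0 Z2) (+) ... (+) (z0 Z2) (+) 0 with m0 copies of z0 Z2, for 2 m0 <= n:
   the row index i lies in the 2 x 2 block number i./2, at position odd i. *)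
Definition swirl_dsum (n m0 : nat) (z0 : R) : 'M[R]_n :=
  \matrix_(i < n, j < n)
    if [&& (i < 2 * m0)%N, (j < 2 * m0)%N & i./2 == j./2]
    then z0 * Z2 (inord (odd i)) (inord (odd j)) else 0.

Definition beta_init (n m0 : nat) (beta0 : R) : 'M[R]_n :=
  scalar_dsum n (2 * m0)
    (beta0 `^ (2 * m0)%:R^-1) (beta0 `^ (- (n - 2 * m0)%:R^-1)).

Definition omega_init (n m0 : nat) (beta0 v : R) : 'M[R]_n :=
  scalar_dsum n (2 * m0)
    ((2 * m0)%:R^-1 * v * beta0 `^ (- (2 * m0)%:R^-1))
    (- ((n - 2 * m0)%:R^-1 * v * beta0 `^ (n - 2 * m0)%:R^-1)).

End InitialData.

(* Main.v *)
(** On the data in question the system reduces to one degree of freedom: with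
    p = 2 m0, q = n - p and kap = 2 p / q, take
      beta = e^(-2x) I_p (+) e^(kap x) I_q,  zeta = z J_p (+) y J_q,
    where J is a direct sum of blocks Z2. The geodesic system becomes the motion
    of x with conserved energy M(x) x'^2 + V(x), where
      M = p e^(2x) + (q kap^2 / 4) e^(-kap x),
      V = (p z^2 / 4) e^(-2x) + (q y^2 / 4) e^(kap x).
    The given data has y = 0: the potential is monotone or zero and x escapes to
    infinity. Giving the shear block a small rotation y != 0 (and z a small
    nonzero value if it vanishes) confines x between two potential walls, so
    that the motion is periodic. *)

Require Import Defs.
From HB Require Import structures.
From mathcomp Require Import all_boot all_order all_algebra.
From mathcomp Require Import all_classical all_reals all_analysis.
From mathcomp Require Import ring lra zify.

Set Implicit Arguments.
Unset Strict Implicit.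
Unset Printing Implicit Defensive.

Import Order.TTheory GRing.Theory Num.Theory.
Import numFieldNormedType.Exports.

Local Open Scope ring_scope.

(** * Real calculus: primitives, inverse functions, separation of variables, polar angles *)

Section RealCalculus.
Context {R : realType}.
Implicit Types (f g F : R -> R) (x y a b l : R).

Lemma is_derive_continuous f x l : is_derive x 1 f l -> {for x, continuous f}.
Proof. by move=> [df _]; apply/differentiable_continuous/derivable1_diffP. Qed.

Lemma near_neq0 (u : R) : u != 0 -> \forall v \near u, v != 0.
Proof.
move=> /eqP; have [u0|u0|//] := ltgtP u 0 => _; near=> v.
  by rewrite lt_eqF//; near: v; exact: lt_nbhsl.
by rewrite gt_eqF//; near: v; exact: lt_nbhsr.
Unshelve. all: by end_near. Qed.

Lemma MVT_cc f (df : R -> R) a b : a < b ->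
  (forall x, a <= x <= b -> is_derive x 1 f (df x)) ->
  exists2 c, a < c < b & f b - f a = df c * (b - a).
Proof.
move=> ab fdf; have [||c cab ->] := @MVT R f df a b ab.
- by move=> x; rewrite in_itv/= => /andP[ax xb]; apply: fdf; rewrite !ltW.
- apply: continuous_in_subspaceT => x; rewrite inE/= in_itv/= => xab.
  by apply: is_derive_continuous; exact: fdf.
by exists c => //; move: cab; rewrite in_itv.
Qed.

Lemma eq_of_derive_cst f g (h : R -> R) a b :
  (forall x, a < x < b -> is_derive x 1 f (h x)) ->
  (forall x, a < x < b -> is_derive x 1 g (h x)) ->
  forall x y, a < x < b -> a < y < b -> f x - f y = g x - g y.
Proof.
move=> fh gh.
suff H x y : a < x < b -> a < y < b -> x < y -> f x - f y = g x - g y.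
  move=> x y xab yab; have [|yx|->] := ltgtP x y; [exact: H| |by rewrite !subrr].
  by apply: oppr_inj; rewrite !opprB; exact: H.
move=> /andP[ax xb] /andP[ay yb] xy.
have [z /andP[xz zy]|c _] := @MVT_cc (f \- g) (fun=> 0) x y xy.
  have zab : a < z < b by rewrite (lt_le_trans ax xz) (le_lt_trans zy yb).
  have ? := fh _ zab; have ? := gh _ zab.
  by apply: is_derive_eq; rewrite subrr.
rewrite mul0r /= => /eqP; rewrite subr_eq0 => /eqP e.
lra.
Qed.

Lemma continuous_primitive_ray f a : continuous f ->
  exists F, forall x, a < x -> is_derive x 1 F (f x).
Proof.
move=> cf.
exists (fun x => \int[lebesgue_measure]_(t in [set` `[a, x]]) (f t)) => x ax.
have [||||dF F'] := @continuous_FTC1_closed R f a x (x + 1).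
- by rewrite ltrDl.
- apply: continuous_compact_integrable; first exact: segment_compact.
  exact: continuous_subspaceT.
- exact: ax.
- exact: cf.
by apply: DeriveDef; [exact: dF | rewrite -derive1E; exact: F'].
Qed.

(** Two one-sided primitives are glued: [F] works to the right of -1, and the reflection [G'] of a
    primitive of f(-x) works to the left of 1. On the overlap they differ by a constant, removed by
    normalising both at 0. *)
Lemma continuous_primitive f : continuous f ->
  exists F, forall x, is_derive x 1 F (f x).
Proof.
move=> cf; have [F dF] := continuous_primitive_ray (-1) cf.
have cfN : continuous (f \o -%R).
  by move=> x; apply: continuous_comp; [exact: opp_continuous | exact: cf].
have [G dG] := continuous_primitive_ray (-1) cfN.
pose G' x := - G (- x).
have dG' x : x < 1 -> is_derive x 1 G' (f x).
  move=> x1.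
  have ? : is_derive (- x) 1 G (f x).
    by have := dG (- x); rewrite /= opprK; apply; rewrite ltrN2.
  have ? : is_derive x 1 (G \o -%R) (f x * -1) by exact: is_derive1_comp.
  by apply: is_derive_eq; rewrite mulrN1 opprK.
pose T x := if x < 0 then G' x - G' 0 else F x - F 0.
have TF x : -1 < x -> T x = F x - F 0.
  rewrite /T => x1; case: ifPn => // x0.
  apply: (@eq_of_derive_cst G' F f (-1) 1).
  - by move=> y /andP[_ ?]; exact: dG'.
  - by move=> y /andP[? _]; exact: dF.
  - by rewrite x1 (lt_trans x0).
  - by rewrite ltr01 oppr_lt0 ltr01.
exists T => x; have [x0|x0] := ltP x 0.
  have ? := dG' x (lt_trans x0 ltr01).
  apply: (@near_eq_is_derive _ _ _ (fun y => G' y - G' 0)).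
    near=> y; rewrite /T ifT//; near: y; exact: lt_nbhsl.
  by apply: is_derive_eq; rewrite subr0.
have x1 : -1 < x by rewrite (lt_le_trans _ x0)// oppr_lt0.
have ? := dF x x1.
apply: (@near_eq_is_derive _ _ _ (fun y => F y - F 0)).
  near=> y; rewrite TF//; near: y; exact: lt_nbhsr.
by apply: is_derive_eq; rewrite subr0.
Unshelve. all: by end_near. Qed.

Lemma derive_pos_increasing f (df : R -> R) :
  (forall x, is_derive x 1 f (df x)) -> (forall x, 0 < df x) ->
  {mono f : x y / x <= y}.
Proof.
move=> dfE df0; apply: le_mono => x y xy.
have [c _ E] := MVT_cc xy (fun x _ => dfE x).
by rewrite -subr_gt0 E mulr_gt0// subr_gt0.
Qed.

Lemma inverse_diffeo f (df : R -> R) :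
  (forall x, is_derive x 1 f (df x)) -> (forall x, 0 < df x) ->
  (forall y, exists x, f x = y) ->
  exists g, [/\ cancel f g, cancel g f
              & forall y, is_derive y 1 g (df (g y))^-1].
Proof.
move=> dfE df0 sf; have fm := derive_pos_increasing dfE df0.
have [g gK] := choice sf.
have fK : cancel f g by move=> x; apply: (inc_inj fm).
exists g; split=> // y; rewrite -{1}(gK y).
apply: is_derive_inverse (dfE _) _; last by rewrite gt_eqF.
  by near=> x; exact: fK.
by near=> x; apply: is_derive_continuous; exact: dfE.
Unshelve. all: by end_near. 
Qed.

(** A slope of at least [c] forces linear growth in both directions, so the values at [- r] and [r]
    enclose [y] and the intermediate value theorem applies. *)
Lemma derive_ge_surjective f (df : R -> R) c : 0 < c ->
  (forall x, is_derive x 1 f (df x)) -> (forall x, c <= df x) ->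
  forall y, exists x, f x = y.
Proof.
move=> c0 dfE dfc y.
have grow a b : a <= b -> c * (b - a) <= f b - f a.
  rewrite le_eqVlt => /predU1P[->|ab]; first by rewrite !subrr mulr0.
  have [d _ ->] := MVT_cc ab (fun x _ => dfE x).
  by rewrite ler_wpM2r// subr_ge0 ltW.
pose r := `|y - f 0| / c.
have r0 : 0 <= r by rewrite divr_ge0// ltW.
have cr : c * r = `|y - f 0| by rewrite mulrC divfK// gt_eqF.
have := grow 0 r r0; have := grow (- r) 0.
rewrite oppr_le0 => /(_ r0); rewrite sub0r opprK subr0 cr => lo hi.
have yn := ler_norm (y - f 0); have yN := ler_norm (- (y - f 0)).
rewrite normrN in yN.
have [|||x _ fx] := @IVT R f (- r) r y.
- by rewrite ge0_cp.
- by apply: continuous_subspaceT => x; apply: is_derive_continuous; exact: dfE.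
- by rewrite ge_min le_max; apply/andP; split; apply/orP; [left|right]; lra.
by exists x.
Qed.

(* Separation of variables: the solution is the inverse of a primitive of H. *)
Lemma scalar_flow (H : R -> R) c u0 : continuous H -> 0 < c ->
  (forall u, c <= H u) ->
  exists phi : R -> R,
    [/\ phi 0 = u0, forall t : R, is_derive t 1 phi (H (phi t))^-1,
        forall u, exists t, phi t = u
      & forall P, 0 < P -> (forall u, H (u + P) = H u) ->
          exists2 T, 0 < T & forall t, phi (t + T) = phi t + P].
Proof.
move=> cH c0 Hc; have [F0 dF0] := continuous_primitive cH.
pose F x := F0 x - F0 u0.
have dF x : is_derive x 1 F (H x).
  by have ? := dF0 x; apply: is_derive_eq; rewrite subr0.
have H0 u : 0 < H u by exact: lt_le_trans (Hc u).
have [g [Fg gF dg]] := inverse_diffeo dF H0 (derive_ge_surjective c0 dF Hc).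
exists g; split=> //.
- by rewrite -[RHS]Fg /F subrr.
- by move=> u; exists (F u).
(* The time period is the increase of [F] over one period of [H]. Since [H] is periodic, F(u + P)
   and F(u) have the same derivative, so this increase is the same from every starting point. *)
move=> P P0 HP; exists (F (u0 + P) - F u0).
  by rewrite subr_gt0 (leW_mono (derive_pos_increasing dF H0)) ltrDl.
move=> t; rewrite -[RHS]Fg; congr g; rewrite -{1}(gF t).
have dFP x : is_derive x 1 (F \o +%R^~ P) (H x).
  have -> : H x = H (x + P) * 1 by rewrite mulr1 HP.
  have dP : is_derive x 1 (+%R^~ P) (1 : R).
    by apply: is_derive_eq; rewrite addr0.
  exact: (@is_derive1_comp R F (+%R^~ P) x _ _ (dF (x + P)) dP).
pose B := `|u0| + `|g t| + 1.
have uB : - B < u0 < B.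
  by have := ler_norm u0; have := ler_norm (- u0); have := normr_ge0 (g t);
     rewrite normrN /B => *; apply/andP; split; lra.
have gB : - B < g t < B.
  by have := ler_norm (g t); have := ler_norm (- g t); have := normr_ge0 u0;
     rewrite normrN /B => *; apply/andP; split; lra.
have := @eq_of_derive_cst (F \o +%R^~ P) F H (- B) B
  (fun x _ => dFP x) (fun x _ => dF x) _ _ gB uB.
rewrite /=; lra.
Qed.

(** [d] is the Carathéodory slope of [h] at 0: continuous at 0 by construction, and elsewhere
    because it is h(v) / v. The mean value theorem transfers the lower bound from [dh]. *)
Lemma difference_quotient (h dh : R -> R) (c : R) : h 0 = 0 ->
  (forall u : R, is_derive u 1 h (dh u)) -> (forall u, c <= dh u) ->
  exists d : R -> R,
    [/\ continuous d, forall u, h u = u * d u & forall u, c <= d u].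
Proof.
move=> h0 dhE dhc.
have /is_derive1_caratheodory [d [hd cd0 d0]] := dhE 0.
have {}hd u : h u = u * d u by have := hd u; rewrite h0 !subr0 mulrC.
exists d; split => // u.
- have [->|u0] := eqVneq u 0; first exact: cd0.
  apply: (is_derive_continuous (l := dh u / u - h u / u ^+ 2)).
  apply: (@near_eq_is_derive _ _ _ (fun v => h v / v)).
    by apply: filterS (near_neq0 u0) => v v0; rewrite hd mulrC mulKf.
  have ? := dhE u.
  have ? := @is_deriveV _ id u _ _ u0 (is_derive_id u 1).
  apply: is_derive_eq; rewrite /GRing.scale/=; field; exact: u0.
- have [->|u0] := eqVneq u 0; first by rewrite d0.
  have dE : d u = h u / u by rewrite hd mulrC mulKf.
  have /eqP := u0; have [u1|u1|//] := ltgtP u 0 => _.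
    have [s _ E] := MVT_cc u1 (fun x _ => dhE x).
    rewrite dE; move: E; rewrite h0 !sub0r mulrN => /oppr_inj ->.
    by rewrite mulfK.
  have [s _ E] := MVT_cc u1 (fun x _ => dhE x).
  by rewrite dE; move: E; rewrite h0 !subr0 => ->; rewrite mulfK.
Qed.

(** [acos] gives an angle with the right cosine and with sine |b| / r; the sign of [b] chooses
    between it and its opposite. *)
Lemma polar_angle (a b : R) : exists u : R,
  a = Num.sqrt (a ^+ 2 + b ^+ 2) * cos u /\
  b = Num.sqrt (a ^+ 2 + b ^+ 2) * sin u.
Proof.
set r := Num.sqrt _.
have r2 : r ^+ 2 = a ^+ 2 + b ^+ 2 by rewrite sqr_sqrtr// addr_ge0 ?sqr_ge0.
have [r0|r0] := eqVneq r 0.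
  exists 0; move: r2; rewrite r0 expr0n/= => /esym/eqP.
  by rewrite paddr_eq0 ?sqr_ge0// !sqrf_eq0 => /andP[/eqP-> /eqP->]; rewrite !mul0r.
have rgt : 0 < r by rewrite lt_def r0 sqrtr_ge0.
have ar : -1 <= a / r <= 1.
  rewrite -ler_norml normrM normfV (gtr0_norm rgt) ler_pdivrMr// mul1r.
  rewrite -(ger0_norm (ltW rgt)) -ler_sqr ?nnegrE// !real_normK ?num_real//.
  by rewrite r2 lerDl sqr_ge0.
have ca : r * cos (acos (a / r)) = a.
  by rewrite acosK ?in_itv//= mulrC divfK.
have sa : r * sin (acos (a / r)) = `|b|.
  have e : r ^+ 2 * (1 - (a / r) ^+ 2) = b ^+ 2.
    have -> : r ^+ 2 * (1 - (a / r) ^+ 2) = r ^+ 2 - a ^+ 2 by field.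
    by rewrite r2; ring.
  rewrite sin_acos// -{1}(ger0_norm (ltW rgt)) -sqrtr_sqr -sqrtrM ?sqr_ge0//.
  by rewrite e sqrtr_sqr.
have [b0|b0] := leP 0 b.
  by exists (acos (a / r)); rewrite ca sa ger0_norm.
exists (- acos (a / r)); rewrite cosN sinN mulrN ca sa ltr0_norm//.
by rewrite opprK.
Qed.

End RealCalculus.

(** * The square root of a function at a nondegenerate minimum *)

Section QuadraticWell.
Context {R : realType}.
Variables (f d : R -> R) (c : R).
Hypotheses (f0 : f 0 = 0) (df : forall u : R, is_derive u 1 f (u * d u)).
Hypotheses (cd : continuous d) (c0 : 0 < c) (dc : forall u, c <= d u).

(** The mean value theorem for the gap between [f] and a parabola of curvature [k]. Taking k = c
    gives the lower bound on [e], and k = d 0 its continuity at 0. *)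
Let MVT_0 (k u : R) : u != 0 ->
  exists s, [/\ `|s| <= `|u|, 0 <= s * u
              & f u - k / 2 * u ^+ 2 = s * (d s - k) * u].
Proof.
pose F v := f v - k / 2 * v ^+ 2.
have dF (v : R) : is_derive v 1 F (v * (d v - k)).
  have ? := df v; apply: is_derive_eq.
  by rewrite /GRing.scale/=; field.
have F0 : F 0 = 0 by rewrite /F f0 expr0n/= mulr0 subr0.
move=> /eqP un0; have [u0|u0|//] := ltgtP u 0.
- have [s /andP[us s0] E] := MVT_cc u0 (fun x _ => dF x).
  exists s; split; last by move: E; rewrite F0 /F; lra.
  + by rewrite !ltr0_norm// lerN2 ltW.
  + by rewrite mulr_le0// ltW.
- have [s /andP[s0 su] E] := MVT_cc u0 (fun x _ => dF x).
  exists s; split; last by move: E; rewrite F0 /F; lra.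
  + by rewrite !gtr0_norm// ltW.
  + by rewrite mulr_ge0// ltW.
Qed.

(** The value at 0 is the one that makes the quotient continuous: half of [d 0], the second
    derivative of [f] at 0. *)
Let e (u : R) : R := if u == 0 then d 0 / 2 else f u / u ^+ 2.

Let fe u : f u = u ^+ 2 * e u.
Proof.
rewrite /e; case: eqP => [->|/eqP u0]; first by rewrite f0 expr0n mul0r.
by rewrite mulrC divfK// expf_neq0.
Qed.

Let ec u : c / 2 <= e u.
Proof.
rewrite /e; case: eqP => [_|/eqP u0]; first by have := dc 0; lra.
have [s [_ su E]] := MVT_0 c u0.
rewrite ler_pdivlMr ?exprn_even_gt0// -subr_ge0 E mulrAC mulr_ge0//.
by rewrite subr_ge0.
Qed.

Let e_gt0 u : 0 < e u.
Proof. by apply: lt_le_trans (ec u); rewrite divr_gt0. Qed.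

Let e_cont0 : {for 0, continuous e}.
Proof.
apply/cvgrPdist_lt => eps eps0.
have cd0 : {for 0, continuous d} by exact: cd.
move/cvgrPdist_lt : cd0 => /(_ _ eps0)[r /= r0 rd].
exists r => //= u; rewrite /= sub0r normrN => ur.
rewrite /e eqxx; case: eqP => [_|/eqP u0]; first by rewrite subrr normr0.
have [s [su _ E]] := MVT_0 (d 0) u0.
have -> : d 0 / 2 - f u / u ^+ 2 = s / u * (d 0 - d s).
  have -> : f u = d 0 / 2 * u ^+ 2 + s * (d s - d 0) * u by rewrite -E; ring.
  by field.
rewrite normrM; apply: (@le_lt_trans _ _ (1 * `|d 0 - d s|)).
  rewrite ler_wpM2r// normrM normfV ler_pdivrMr ?normr_gt0//.
  by rewrite mul1r.
by rewrite mul1r; apply: rd => /=; rewrite sub0r normrN (le_lt_trans su).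
Qed.

Let de (u : R) : u != 0 ->
  is_derive u 1 e (d u / u - 2 * f u / u ^+ 3).
Proof.
move=> u0; apply: (@near_eq_is_derive _ _ _ (fun v => f v / v ^+ 2)).
  by apply: filterS (near_neq0 u0) => v v0; rewrite /e (negbTE v0).
have ? := df u.
have dsq : is_derive u 1 (fun v : R => v ^+ 2) (2 * u).
  by apply: is_derive_eq; rewrite /GRing.scale/=; ring.
have ? := @is_deriveV _ (fun v : R => v ^+ 2) u _ _ (expf_neq0 2 u0) dsq.
apply: is_derive_eq; rewrite /GRing.scale/=; field; exact: u0.
Qed.

(** The square root of [f] with the sign of [u]. Its derivative [g] comes from 2 w w' = u d(u) after
    cancelling u. *)
Let w (u : R) := u * Num.sqrt (e u).
Let g (u : R) := d u / (2 * Num.sqrt (e u)).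

Let dw (u : R) : is_derive u 1 w (g u).
Proof.
have se : 0 < Num.sqrt (e u) by rewrite sqrtr_gt0.
have [u0|u0] := eqVneq u 0.
  (* At 0 the continuity of [e] suffices: w(v) = v sqrt(e v) exhibits sqrt(e) as the slope. *)
  apply/is_derive1_caratheodory; exists (fun v => Num.sqrt (e v)); split.
  - by move=> z; rewrite /w u0 mul0r !subr0 mulrC.
  - apply: continuous_comp; first by rewrite u0; exact: e_cont0.
    exact: sqrt_continuous.
  - have e0 : d u = 2 * Num.sqrt (e u) ^+ 2.
      by rewrite sqr_sqrtr ?ltW// u0 /e eqxx; field.
    by rewrite /g e0; field; rewrite gt_eqF.
have ? := de u0.
have ? : is_derive (e u) 1 Num.sqrt (2 * Num.sqrt (e u))^-1.
  exact: is_derive1_sqrt.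
have ? : is_derive u 1 (Num.sqrt \o e)
    ((2 * Num.sqrt (e u))^-1 * (d u / u - 2 * f u / u ^+ 3)).
  exact: is_derive1_comp.
apply: is_derive_eq; rewrite /GRing.scale/= /g.
have -> : f u = u ^+ 2 * Num.sqrt (e u) ^+ 2 by rewrite sqr_sqrtr ?ltW// fe.
by field; rewrite gt_eqF//= u0.
Qed.

(* The square root of a function with a nondegenerate minimum is a
   C^1 diffeomorphism, even through the minimum. *)
Lemma sqrt_well : exists w g : R -> R,
  [/\ forall u : R, is_derive u 1 w (g u), continuous g, forall u, 0 < g u,
      forall y, exists u, w u = y
    & forall u, w u ^+ 2 = f u /\ w u * g u = u * d u / 2].
Proof.
exists w, g; split.
- exact: dw.
- have ce : continuous e.
    move=> u; have [->|u0] := eqVneq u 0; first exact: e_cont0.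
    exact: is_derive_continuous (de u0).
  move=> u; apply: cvgM; first exact: cd.
  apply: cvgV; first by rewrite mulf_neq0// gt_eqF// sqrtr_gt0.
  apply: cvgMr; apply: continuous_comp; first exact: ce.
  exact: sqrt_continuous.
- move=> u; rewrite divr_gt0 ?mulr_gt0 ?sqrtr_gt0//.
  exact: lt_le_trans (dc u).
(* Since e >= c / 2 and r sqrt(c / 2) = |y|, the values of [w] at [- r] and [r] enclose [y]. *)
- move=> y; pose r := `|y| / Num.sqrt (c / 2).
  have s0 : 0 < Num.sqrt (c / 2) by rewrite sqrtr_gt0 divr_gt0.
  have r0 : 0 <= r by rewrite divr_ge0// ltW.
  have se u : Num.sqrt (c / 2) <= Num.sqrt (e u) by rewrite ler_sqrt// ltW.
  have rs : r * Num.sqrt (c / 2) = `|y| by rewrite divfK// gt_eqF.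
  have hi : y <= w r.
    rewrite (le_trans (ler_norm y))// -rs ler_wpM2l//.
  have lo : w (- r) <= y.
    rewrite /w mulNr lerNl (le_trans (ler_norm _))// normrN -rs ler_wpM2l//.
  have [|||u _ <-] := @IVT R w (- r) r y.
  - by rewrite ge0_cp.
  - by apply: continuous_subspaceT => u; apply: is_derive_continuous (dw u).
  - by rewrite ge_min le_max lo hi orbT.
  by exists u.
- move=> u; split; first by rewrite exprMn sqr_sqrtr ?ltW// fe.
  by rewrite /w /g; field; rewrite gt_eqF// sqrtr_gt0.
Qed.

End QuadraticWell.

(** * Motion along a level set of the energy *)

Section ConservativeMotion.
Context {R : realType}.
Variables (M dM dV : R -> R).
Hypotheses (M0 : forall x, 0 < M x) (dME : forall x : R, is_derive x 1 M (dM x)).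

(* The Euler-Lagrange equation of the energy M(x) x'^2 + V(x), with velocity k
   and dV the derivative of V. *)
Definition conservative_motion (x k : R -> R) : Prop := forall t : R,
  is_derive t 1 x (k t) /\
  is_derive t 1 k (- (dM (x t) * k t ^+ 2 + dV (x t)) / (2 * M (x t))).

(* (X, Y) parametrises a level set of the energy in the coordinates
   (x, sqrt M x'), and H is the derivative of time along it. *)
Lemma phase_curve_motion (X Y H : R -> R) (c u0 : R) :
  continuous H -> 0 < c -> (forall u, c <= H u) ->
  (forall u : R, is_derive u 1 X (Y u * H u / Num.sqrt (M (X u)))) ->
  (forall u : R, is_derive u 1 Y (- dV (X u) * H u / (2 * Num.sqrt (M (X u))))) ->
  exists x k : R -> R,
    [/\ conservative_motion x k, x 0 = X u0, k 0 = Y u0 / Num.sqrt (M (X u0)),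
        forall u, exists t, x t = X u
      & forall P, 0 < P -> (forall u, X (u + P) = X u) ->
          (forall u, Y (u + P) = Y u) -> (forall u, H (u + P) = H u) ->
          exists2 T, 0 < T & forall t, x (t + T) = x t /\ k (t + T) = k t].
Proof.
move=> cH c0 Hc dX dY.
(* The curve is followed at the parameter phi(t) with phi' = 1 / H(phi); the lower bound on [H]
   makes phi defined for all times. *)
have [phi [phi0 dphi phi_surj phi_per]] := scalar_flow u0 cH c0 Hc.
have H0 u : 0 < H u by exact: lt_le_trans (Hc u).
pose x t := X (phi t); pose N t := Num.sqrt (M (x t)).
have N0 t : 0 < N t by rewrite sqrtr_gt0.
have N2 t : M (x t) = N t ^+ 2 by rewrite sqr_sqrtr// ltW.
pose k t := Y (phi t) / N t.
have dx (t : R) : is_derive t 1 x (k t).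
  have -> : k t = (Y (phi t) * H (phi t) / N t) * (H (phi t))^-1.
    by rewrite /k; field; rewrite !gt_eqF.
  exact: (@is_derive1_comp R X phi t _ _ (dX _) (dphi _)).
exists x, k; split.
- move=> t; split; first exact: dx.
  have dYt := @is_derive1_comp R Y phi t _ _ (dY _) (dphi _).
  have dMt := @is_derive1_comp R M x t _ _ (dME _) (dx _).
  have dNt := @is_derive1_comp R Num.sqrt (M \o x) t _ _
    (is_derive1_sqrt (M0 _)) dMt.
  have dNV := is_deriveV (f := Num.sqrt \o (M \o x)) (lt0r_neq0 (N0 t)) dNt.
  have dYNV := is_deriveM (f := Y \o phi) dYt dNV.
  rewrite [X in is_derive _ _ X _](_ : k =
    (Y \o phi) * (fun y => ((Num.sqrt \o (M \o x)) y)^-1)) //.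
  apply: is_derive_eq; rewrite /GRing.scale/= -/(x t) -/(N t) /k N2.
  by field; rewrite !gt_eqF.
- by rewrite /x phi0.
- by rewrite /k /N /x phi0.
- by move=> u; have [t tu] := phi_surj u; exists t; rewrite /x tu.
- move=> P P0 XP YP HP; have [T T0 TP] := phi_per P P0 HP.
  by exists T => // t; rewrite /k /N /x TP XP YP.
Qed.

End ConservativeMotion.


(** * Kinetic and potential energy of the reduced system *)

Section SwirlEnergy.
Context {R : realType}.
Variables (p q kap : R).
Hypotheses (p0 : 0 < p) (q0 : 0 < q) (kap0 : 0 < kap).

(* For A = e^x I_p (+) e^(- kap x / 2) I_q with kap = 2 p / q, so that det A = 1,
   the squared speed |A'|^2 is inertia(x) x'^2, and the rotation rates z, y of the
   two blocks contribute potential(x). *)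
Definition inertia (x : R) : R :=
  p * expR (2 * x) + q * kap ^+ 2 / 4 * expR (- kap * x).

Definition dinertia (x : R) : R :=
  2 * p * expR (2 * x) - q * kap ^+ 3 / 4 * expR (- kap * x).

Definition potential (z y x : R) : R :=
  p * z ^+ 2 / 4 * expR (- 2 * x) + q * y ^+ 2 / 4 * expR (kap * x).

Definition dpotential (z y x : R) : R :=
  - (p * z ^+ 2 / 2) * expR (- 2 * x) + q * kap * y ^+ 2 / 4 * expR (kap * x).

Lemma is_derive_expRM (a x : R) :
  is_derive x 1 (fun x => expR (a * x)) (a * expR (a * x)).
Proof.
have d : is_derive x 1 ( *%R a) a.
  by apply: is_derive_eq; rewrite /GRing.scale/= mulr1.
by rewrite mulrC; exact: (@is_derive1_comp R expR ( *%R a) x _ _ _ d).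
Qed.

Lemma is_derive_inertia (x : R) : is_derive x 1 inertia (dinertia x).
Proof.
have ? := is_derive_expRM 2 x; have ? := is_derive_expRM (- kap) x.
by apply: is_derive_eq; rewrite /GRing.scale/= /dinertia; field.
Qed.

Lemma is_derive_potential (z y x : R) :
  is_derive x 1 (potential z y) (dpotential z y x).
Proof.
have ? := is_derive_expRM (- 2) x; have ? := is_derive_expRM kap x.
by apply: is_derive_eq; rewrite /GRing.scale/= /dpotential; field.
Qed.

Let m := Num.min p (q * kap ^+ 2 / 4).

Let m0 : 0 < m.
Proof. by rewrite lt_min p0 divr_gt0// mulr_gt0// exprn_gt0. Qed.

(** Whatever the sign of x, one of the two exponentials is at least 1. For the escaping motions,
    this bound keeps the time density [H] away from 0. *)
Lemma inertia_ge x : m <= inertia x.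
Proof.
have c0 : 0 < q * kap ^+ 2 / 4 by rewrite divr_gt0// mulr_gt0// exprn_gt0.
rewrite /m /inertia ge_min; have [x0|x0] := leP 0 x; apply/orP; [left|right].
  rewrite -[leLHS]addr0 lerD//; last by rewrite mulr_ge0 ?expR_ge0// ltW.
  by rewrite ler_peMr ?(ltW p0)// -expR0 ler_expR mulr_ge0.
rewrite -[leLHS]add0r lerD//; first by rewrite mulr_ge0 ?expR_ge0// ltW.
rewrite ler_peMr ?(ltW c0)// -expR0 ler_expR mulNr -mulrN mulr_ge0 ?(ltW kap0)//.
by rewrite oppr_ge0 ltW.
Qed.

Lemma inertia_gt0 x : 0 < inertia x.
Proof. exact: lt_le_trans (inertia_ge x). Qed.

Lemma sqrt_inertia_continuous (X : R -> R) : continuous X ->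
  continuous (fun u => Num.sqrt (inertia (X u))).
Proof.
move=> cX u; apply: continuous_comp; last exact: sqrt_continuous.
apply: continuous_comp; first exact: cX.
exact: is_derive_continuous (is_derive_inertia _).
Qed.

End SwirlEnergy.

(** Logarithms turn the balance into (2 + kap) x = ln (a / b). The solution serves as the
    equilibrium of the confining potential. *)
Lemma force_balance {R : realType} (kap a b : R) : 0 < kap -> 0 < a -> 0 < b ->
  exists x, b * expR (kap * x) = a * expR (- 2 * x).
Proof.
move=> kap0 a0 b0; exists (ln (a / b) / (2 + kap)); set x := _ / _.
have -> : kap * x = ln (a / b) + - 2 * x.
  by rewrite /x; field; rewrite gt_eqF// addr_gt0.
rewrite expRD lnK ?posrE ?divr_gt0//; field.
by rewrite gt_eqF.
Qed.

(** * Escaping and oscillating motions *)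

Section EscapeAndOscillation.
Context {R : realType}.
Variables (p q kap : R).
Hypotheses (p0 : 0 < p) (q0 : 0 < q) (kap0 : 0 < kap).

Let M := inertia p q kap.
Let dM := dinertia p q kap.
Let V := potential p q kap.
Let dV := dpotential p q kap.
Let Mgt0 x : 0 < M x. Proof. exact: inertia_gt0. Qed.
Let sMgt0 x : 0 < Num.sqrt (M x). Proof. by rewrite sqrtr_gt0. Qed.
Let dME (x : R) : is_derive x 1 M (dM x). Proof. exact: is_derive_inertia. Qed.

Let sqrt_inertia_bounded_below : exists2 c, 0 < c & forall x, c <= Num.sqrt (M x).
Proof.
exists (Num.sqrt (Num.min p (q * kap ^+ 2 / 4))).
  by rewrite sqrtr_gt0 lt_min p0 divr_gt0// mulr_gt0// exprn_gt0.
by move=> x; rewrite ler_sqrt ?inertia_ge// ltW.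
Qed.

(** Without potential, sqrt(M) x' keeps its initial value [c], so the level set is X(u) = c u, Y(u)
    = c with dt/du = sqrt(M). As [c] is nonzero, x takes every real value; large ones may lie in the
    past. *)
Lemma free_motion_escapes (x0 k0 : R) : k0 != 0 ->
  exists x k : R -> R,
    [/\ conservative_motion M dM (dV 0 0) x k, x 0 = x0, k 0 = k0
      & forall B, exists t, B <= x t].
Proof.
move=> k00; pose c := k0 * Num.sqrt (M x0).
have c0 : c != 0 by rewrite mulf_neq0// gt_eqF.
have dX (u : R) : is_derive u 1 ( *%R c) c.
  by apply: is_derive_eq; rewrite /GRing.scale/= mulr1.
have cX : continuous ( *%R c) by move=> u; exact: is_derive_continuous (dX u).
have [m m0 mM] := sqrt_inertia_bounded_below.
have [|||||x [k [xk x00 k00' xs _]]] := @phase_curve_motion R M dM (dV 0 0) Mgt0 dME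
  ( *%R c) (fun=> c) (fun u => Num.sqrt (M (c * u))) m (x0 / c).
- exact: sqrt_inertia_continuous.
- exact: m0.
- by move=> u; exact: mM.
- by move=> u; rewrite mulfK ?gt_eqF.
- move=> u; apply: is_derive_eq; rewrite /dV /dpotential expr0n/=.
  by rewrite !(mulr0, mul0r, oppr0, addr0).
have cx0 : c * (x0 / c) = x0 by rewrite mulrC divfK.
exists x, k; split=> //; first by rewrite x00 cx0.
  by rewrite k00' cx0 /c mulfK// gt_eqF.
by move=> B; have [t tB] := xs (B / c); exists t; rewrite tB mulrC divfK.
Qed.

Let ch (u : R) := (expR u + expR (- u)) / 2.
Let sh (u : R) := (expR u - expR (- u)) / 2.

Let dexpN (u : R) : is_derive u 1 (fun u : R => expR (- u)) (- expR (- u)).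
Proof.
have := is_derive_expRM (-1) u; rewrite !mulN1r.
rewrite (_ : (fun x => expR (-1 * x)) = fun u => expR (- u))//.
by apply/funext => v; rewrite mulN1r.
Qed.

Let dch (u : R) : is_derive u 1 ch (sh u).
Proof.
by have ? := dexpN u; apply: is_derive_eq; rewrite /GRing.scale/= /sh; field.
Qed.

Let dsh (u : R) : is_derive u 1 sh (ch u).
Proof.
by have ? := dexpN u; apply: is_derive_eq; rewrite /GRing.scale/= /ch; field.
Qed.

Let ch_sh u : ch u ^+ 2 = 1 + sh u ^+ 2.
Proof.
have e : expR u * expR (- u) = 1 by rewrite -expRD subrr expR0.
have : ch u ^+ 2 - sh u ^+ 2 = expR u * expR (- u).
  by rewrite /ch /sh; field.
by rewrite e => <-; rewrite subrK.
Qed.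

Let ch_gt0 u : 0 < ch u.
Proof. by rewrite divr_gt0// addr_gt0 ?expR_gt0. Qed.

Let ch_ge1 u : 1 <= ch u.
Proof.
rewrite -(ler_sqr (x := 1)) ?nnegrE// ?(ltW (ch_gt0 _))//.
by rewrite expr1n ch_sh lerDl sqr_ge0.
Qed.

(* With M x'^2 + a e^{-2x} = E, the level set of the energy is
   e^x = sqrt (a / E) cosh u, sqrt M x' = sqrt E tanh u. *)
Lemma repelled_motion_escapes (z x0 k0 : R) : z != 0 ->
  exists x k : R -> R,
    [/\ conservative_motion M dM (dV z 0) x k, x 0 = x0, k 0 = k0
      & forall B, exists t, B <= x t].
Proof.
(* Here [a] is the whole initial potential energy, factor e^(-2 x0) included. Solving sinh u0 = k0
   sqrt(M x0) / b makes the total energy b^2 cosh^2 u0 = S^2. *)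
move=> z0; pose a := p * z ^+ 2 / 4 * expR (- 2 * x0).
have a0 : 0 < a by rewrite mulr_gt0 ?expR_gt0// divr_gt0// mulr_gt0// exprn_even_gt0.
pose b := Num.sqrt a; have b0 : 0 < b by rewrite sqrtr_gt0.
have [u0 shu0] := derive_ge_surjective ltr01 dsh ch_ge1 (k0 * Num.sqrt (M x0) / b).
pose S := b * ch u0; have S0 : 0 < S by rewrite mulr_gt0.
pose X u := x0 + (ln (ch u) - ln (ch u0)).
have dX (u : R) : is_derive u 1 X (sh u / ch u).
  have ? := @is_derive1_comp R (@ln R) ch u _ _ (is_derive1_ln (ch_gt0 u)) (dch u).
  apply: (@is_derive_eq _ _ _ (fun u => x0 + ((@ln R \o ch) u - ln (ch u0)))).
  by rewrite subr0 add0r mul1r mulrC.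
have cX : continuous X by move=> u; exact: is_derive_continuous (dX u).
have [m m0 mM] := sqrt_inertia_bounded_below.
have [|||||x [k [xk x00 k00' xs _]]] := @phase_curve_motion R M dM (dV z 0) Mgt0 dME
  X (fun u => S * (sh u / ch u)) (fun u => Num.sqrt (M (X u)) / S) (m / S) u0.
- move=> u; apply: cvgMl; exact: sqrt_inertia_continuous.
- by rewrite divr_gt0.
- by move=> u; rewrite ler_pM2r ?invr_gt0.
- move=> u; rewrite (_ : _ / _ = sh u / ch u)//.
  by field; rewrite !gt_eqF.
- move=> u; have ? := dch u; have ? := dsh u.
  have ? := is_deriveV (lt0r_neq0 (ch_gt0 u)) (dch u).
  apply: is_derive_eq; rewrite /GRing.scale/= /dV /dpotential expr0n/=.
  have -> : expR (- 2 * X u) = expR (- 2 * x0) * (ch u0 / ch u) ^+ 2.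
    have -> : - 2 * X u = - 2 * x0 + ((ln (ch u0) - ln (ch u)) + (ln (ch u0) - ln (ch u))).
      by rewrite /X; ring.
    by rewrite !expRD expRN !lnK ?posrE// expr2.
  have -> : p * z ^+ 2 / 2 = 2 * (b ^+ 2 / expR (- 2 * x0)).
    rewrite sqr_sqrtr ?(ltW a0)// /a; field; rewrite gt_eqF// expR_gt0//.
  have -> : b = S / ch u0 by rewrite mulfK// gt_eqF.
  transitivity (S * (ch u ^+ 2 - sh u ^+ 2) / ch u ^+ 2).
    by move: (ch u) (sh u) (ch_gt0 u) => cu su cu0; field; rewrite gt_eqF.
  have -> : ch u ^+ 2 - sh u ^+ 2 = 1 by rewrite ch_sh addrK.
  field.
  by rewrite !gt_eqF ?expR_gt0.
exists x, k; split=> //; first by rewrite x00 /X subrr addr0.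
  rewrite k00' shu0 /X subrr addr0 /S; field.
  by rewrite !gt_eqF.
move=> B.
(* The shift by ln 2 makes up for the factor 1/2 in cosh: ch(s + ln 2) >= e^s. *)
have Bu : B <= X (B - x0 + ln (ch u0) + ln 2).
  have : B - x0 + ln (ch u0) <= ln (ch (B - x0 + ln (ch u0) + ln 2)).
    rewrite -ler_expR lnK ?posrE// ler_pdivlMr//.
    rewrite [expR (_ + ln 2)]expRD [expR (ln 2)]lnK ?posrE// lerDl.
    by rewrite expR_ge0.
  by rewrite /X; lra.
by have [t tB] := xs (B - x0 + ln (ch u0) + ln 2); exists t; rewrite tB.
Qed.

(** Around the equilibrium [xe], V(xe + u) - V(xe) = w(u)^2 for a diffeomorphism [w], so in the
    coordinates (sqrt(M) x', w(x - xe)) an energy level is a circle. Its angle parametrises the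
    motion, with a time density of period 2 pi. Radius 0 is rest at [xe] and is handled by the same
    formulas. *)
Lemma oscillating_motion (z y x0 k0 : R) : z != 0 -> y != 0 ->
  exists x k : R -> R,
    [/\ conservative_motion M dM (dV z y) x k, x 0 = x0, k 0 = k0
      & exists2 T, 0 < T & forall t, x (t + T) = x t /\ k (t + T) = k t].
Proof.
move=> z0 y0.
have z2 : 0 < z ^+ 2 by rewrite exprn_even_gt0.
have y2 : 0 < y ^+ 2 by rewrite exprn_even_gt0.
pose a : R := p * z ^+ 2 / 2; pose b : R := q * kap * y ^+ 2 / 4.
have a0 : 0 < a by rewrite divr_gt0// mulr_gt0.
have b0 : 0 < b by rewrite divr_gt0// mulr_gt0// mulr_gt0.
have [xe xeE] := force_balance kap0 a0 b0.
pose A := a * expR (- 2 * xe).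
have A0 : 0 < A by rewrite mulr_gt0// expR_gt0.
(* Measured from the equilibrium, both exponentials in the derivative of the potential get the same
   coefficient [A], so it vanishes at 0. *)
pose h u := A * (expR (kap * u) - expR (- 2 * u)).
pose dh u := A * (kap * expR (kap * u) + 2 * expR (- 2 * u)).
have dVh u : dV z y (xe + u) = h u.
  transitivity (- (a * expR (- 2 * xe)) * expR (- 2 * u)
                + b * expR (kap * xe) * expR (kap * u)).
    by rewrite /dV /dpotential !mulrDr !expRD /a /b; ring.
  by rewrite xeE /h /A; ring.
have dhE (u : R) : is_derive u 1 h (dh u).
  have ? := is_derive_expRM (- 2) u; have ? := is_derive_expRM kap u.
  by apply: is_derive_eq; rewrite /GRing.scale/= /dh; ring.
pose c := A * Num.min kap 2.
have c0 : 0 < c by rewrite mulr_gt0// lt_min kap0 ltr0n.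
have dhc u : c <= dh u.
  rewrite ler_wpM2l ?(ltW A0)// ge_min; have [u0|u0] := leP 0 u; apply/orP; [left|right].
    rewrite -[leLHS]addr0 lerD ?mulr_ge0 ?expR_ge0//.
    by rewrite ler_peMr ?(ltW kap0)// -expR0 ler_expR mulr_ge0// ltW.
  rewrite -[leLHS]add0r lerD//; first by rewrite mulr_ge0 ?expR_ge0// ltW.
  by rewrite ler_peMr// -expR0 ler_expR mulNr -mulrN mulr_ge0// oppr_ge0 ltW.
have h0 : h 0 = 0 by rewrite /h !mulr0 subrr mulr0.
have [d [cd hd dc]] := difference_quotient h0 dhE dhc.
pose f u := V z y (xe + u) - V z y xe.
have f0 : f 0 = 0 by rewrite /f addr0 subrr.
have df (u : R) : is_derive u 1 f (u * d u).
  have dsh1 : is_derive u 1 ( +%R xe) (1 : R).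
    by apply: is_derive_eq; rewrite add0r.
  have ? := @is_derive1_comp R (V z y) ( +%R xe) u _ _
    (is_derive_potential p q kap z y _) dsh1.
  apply: (@is_derive_eq _ _ _ (fun u => (V z y \o +%R xe) u - V z y xe)).
  by rewrite subr0 mulr1 -hd -dVh.
have [w [g [dw cg g0 ws wE]]] := sqrt_well f0 df cd c0 dc.
have [W [wW Ww dW]] := inverse_diffeo dw g0 ws.
have cW : continuous W by move=> s; exact: is_derive_continuous (dW s).
pose Y0 := k0 * Num.sqrt (M x0).
have [u0] := polar_angle Y0 (w (x0 - xe)).
set r := Num.sqrt _ => -[cu0 su0].
have r0 : 0 <= r by exact: sqrtr_ge0.
(* Time per unit of angle: x = xe + W(r sin u) has dx/du = r cos u / g, while x' = r cos u /
   sqrt(M). *)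
pose K s := Num.sqrt (M (xe + W s)) / g (W s).
have cK : continuous K.
  move=> s; apply: cvgM; last first.
    apply: cvgV; first by rewrite gt_eqF.
    by apply: continuous_comp; [exact: cW | exact: cg].
  apply: (sqrt_inertia_continuous (X := fun s => xe + W s)) => v.
  by apply: cvgD; [exact: cvg_cst | exact: cW].
have K0 s : 0 < K s by rewrite divr_gt0.
(* As r sin u stays in [-r, r], the minimum of [K] there is the positive lower bound required of the
   time density. *)
have [||s0 _ Ks0] := @EVT_min R K (- r) r; first by rewrite ge0_cp.
  exact: continuous_subspaceT.
pose X u := xe + W (r * sin u).
have drs (u : R) : is_derive u 1 (fun u => r * sin u) (r * cos u).
  by apply: is_derive_eq; rewrite /GRing.scale/=.
have [|||||x [k [xk x00 k00 _ per]]] := @phase_curve_motion R M dM (dV z y) Mgt0 dME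
  X (fun u => r * cos u) (fun u => K (r * sin u)) (K s0) u0.
- move=> u; apply: (@continuous_comp _ _ _ (fun u => r * sin u) K); last exact: cK.
  exact: is_derive_continuous (drs u).
- exact: K0.
- move=> u; apply: Ks0; rewrite in_itv/= -ler_norml normrM (ger0_norm r0).
  by rewrite ler_piMr// ler_norml sin_geN1 sin_le1.
- move=> u; have ? := @is_derive1_comp R W (fun u => r * sin u) u _ _ (dW _) (drs u).
  apply: (@is_derive_eq _ _ _ (fun v => xe + (W \o (fun u => r * sin u)) v)).
  by rewrite add0r /K -/(X u); field; rewrite !gt_eqF.
- move=> u; apply: is_derive_eq; rewrite /GRing.scale/= /X dVh hd.
  have [_] := wE (W (r * sin u)); rewrite Ww => E.
  have -> : W (r * sin u) * d (W (r * sin u)) = 2 * (r * sin u * g (W (r * sin u))).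
    by rewrite E; field.
  by rewrite /K; field; rewrite !gt_eqF.
exists x, k.
have X0 : X u0 = x0 by rewrite /X -su0 wW addrC subrK.
split=> //; first by rewrite x00 X0.
  by rewrite k00 X0 -cu0 /Y0 mulfK// gt_eqF.
apply: (per (pi *+ 2)).
- by rewrite mulrn_wgt0// pi_gt0.
- by move=> u; rewrite /X sinD2pi.
- by move=> u; rewrite cosD2pi.
- by move=> u; rewrite sinD2pi.
Qed.

End EscapeAndOscillation.

(** * Algebra of two-block scalar matrices and of the block rotation *)

Section Swirl.
Context {R : realType}.
Variables (m m0 : nat).
Local Notation n := (2 * m)%N.
Local Notation D := (@scalar_dsum R n (2 * m0)).

Lemma scalar_dsumM a b c d : D a b *m D c d = D (a * c) (b * d).
Proof.
rewrite /scalar_dsum mulmx_diag; congr diag_mx; apply/rowP => i.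
by rewrite !mxE; case: ifP.
Qed.

Lemma scalar_dsumD a b c d : D a b + D c d = D (a + c) (b + d).
Proof.
rewrite /scalar_dsum -raddfD/=; congr diag_mx; apply/rowP => i.
by rewrite !mxE; case: ifP.
Qed.

Lemma scalar_dsumZ c a b : c *: D a b = D (c * a) (c * b).
Proof.
rewrite /scalar_dsum -linearZ/=; congr diag_mx; apply/rowP => i.
by rewrite !mxE; case: ifP.
Qed.

Lemma scalar_dsumN a b : - D a b = D (- a) (- b).
Proof. by rewrite -scaleN1r scalar_dsumZ !mulN1r. Qed.

Lemma scalar_dsum_cst a : a%:M = D a a.
Proof.
rewrite /scalar_dsum -diag_const_mx; congr diag_mx; apply/rowP => i.
by rewrite !mxE if_same.
Qed.

Lemma scalar_dsumT a b : (D a b)^T = D a b.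
Proof. exact: tr_diag_mx. Qed.

Lemma big_ord_if (T : Type) (idx : T) (op : Monoid.law idx) (k l : nat) (a b : T) :
  (k <= l)%N ->
  \big[op/idx]_(i < l) (if (i < k)%N then a else b) =
  op (\big[op/idx]_(0 <= i < k) a) (\big[op/idx]_(k <= i < l) b).
Proof.
move=> kl; rewrite -(big_mkord xpredT (fun i => if (i < k)%N then a else b)).
rewrite (big_cat_nat (n := k))//=; congr (op _ _).
  by apply: eq_big_nat => i /andP[_ ->].
by apply: eq_big_nat => i /andP[ki _]; rewrite ltnNge ki.
Qed.

Lemma posdef_scalar_dsum a b : 0 < a -> 0 < b -> posdefmx (D a b).
Proof.
move=> a0 b0; split=> [|x x0]; first exact: scalar_dsumT.
have [i [j]] := matrix0Pn _ x0; rewrite ord1 => xi0.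
have pos l : 0 < (if (l < 2 * m0)%N then a else b) by case: ifP.
rewrite mul_mx_diag mxE (bigD1 i)//= ltr_pwDl//.
  by rewrite !mxE mulrAC mulr_gt0// -expr2 exprn_even_gt0.
by apply: sumr_ge0 => l _; rewrite !mxE mulrAC mulr_ge0 ?(ltW (pos l))// -expr2 sqr_ge0.
Qed.

(** A complex structure on the whole space: the formula of [swirl_dsum] without its cutoff. Angular
    parts factor as [D z y *m J], and computations rest on J^2 = -1 and on [J] commuting with
    [D]. *)
Definition swirlmx : 'M[R]_n :=
  \matrix_(i, j) if i./2 == j./2 then Z2 R (inord (odd i)) (inord (odd j)) else 0.
Local Notation J := swirlmx.

Let Z2E (a b : bool) :
  Z2 R (inord a) (inord b) = if a == b then 0 else if a then 1 else -1.
Proof.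
have ob (c : bool) : (inord c : 'I_2) = c :> nat.
  by rewrite inordK//; case: c.
rewrite /Z2 mxE; case: splitP => i; rewrite ob (ord1 i) => ai;
  rewrite mxE; case: splitP => j; rewrite ob (ord1 j) => bj; rewrite !mxE;
  by move: ai bj; case: a; case: b.
Qed.

Let JE (i j : 'I_n) : J i j =
  if (i./2 == j./2) && (odd i != odd j) then if odd i then 1 else -1 else 0.
Proof. by rewrite mxE Z2E; case: eqP => //= _; case: eqP. Qed.

Lemma swirlmx_le1 (i j : 'I_n) : `|J i j| <= 1.
Proof.
by rewrite JE; case: ifP; [case: ifP|]; rewrite ?normrN ?normr1 ?normr0.
Qed.

Lemma swirlmxT : J^T = - J.
Proof.
apply/matrixP => i j; rewrite mxE [RHS]mxE !JE eq_sym (eq_sym (odd j)).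
by case: ifP; rewrite ?oppr0// => /andP[_]; case: (odd i); case: (odd j); rewrite ?opprK.
Qed.

Lemma swirlmx_sqr : J *m J = - 1%:M.
Proof.
apply/matrixP => i l; rewrite !mxE.
(* [s] is the partner of [i] in its 2 x 2 block, the only column where row [i] of [J] is nonzero. *)
have sP : ((if odd i then i.-1 else i.+1) < n)%N.
  have := ltn_ord i; case: ifP; lia.
pose s := Ordinal sP.
have sE (j : 'I_n) : ((i./2 == j./2) && (odd i != odd j)) = (j == s).
  by rewrite -val_eqE /=; case: ifP; lia.
rewrite (bigD1 s)//= big1 ?addr0; last first.
  by move=> j js; rewrite JE sE (negbTE js) mul0r.
rewrite !JE sE eqxx/=.
have [sh so] : s./2 = i./2 /\ odd s = ~~ odd i.
  split; rewrite /=; first by case: ifP; lia.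
  by case: (nat_of_ord i) => //= k; case E: (odd k); rewrite /= E.
have -> : ((s./2 == l./2) && (odd s != odd l)) = (i == l).
  have e : (~~ odd i != odd l) = (odd i == odd l) by do 2 case: odd.
  rewrite sh so e; apply/andP/eqP => [[/eqP h /eqP o]|->//].
  by apply: val_inj; rewrite /= -(odd_double_half i) -(odd_double_half l) h o.
rewrite so; case: eqP => _; case: (odd i);
  by rewrite /= ?mulr0 ?mulr0n ?oppr0 ?mulrN ?mulr1 ?mul1r ?mulNr.
Qed.

(** The cut between the blocks of [D] falls at the even index 2 m0, so it never splits a 2 x 2 block
    of [J]. *)
Lemma swirlmxC a b : J *m D a b = D a b *m J.
Proof.
rewrite mul_mx_diag mul_diag_mx; apply/matrixP => i j; rewrite !mxE.
case: eqP => [ij|_]; last by rewrite mulr0 mul0r.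
have -> : (i < 2 * m0)%N = (j < 2 * m0)%N by lia.
by rewrite mulrC.
Qed.

Lemma swirl_dsumE z : swirl_dsum n m0 z = D z 0 *m J.
Proof.
rewrite mul_diag_mx; apply/matrixP => i j; rewrite !mxE.
case: (ltnP i (2 * m0)) => im; last by rewrite /= mul0r.
case: (eqVneq i./2 j./2) => [ij|_]; last by rewrite !andbF mulr0.
by have -> : (j < 2 * m0)%N by lia.
Qed.

Hypothesis m0m : (m0 <= m)%N.

Let kn : (2 * m0 <= n)%N. Proof. by rewrite leq_mul2l. Qed.

Lemma tr_scalar_dsum a b :
  \tr (D a b) = (2 * m0)%:R * a + (n - 2 * m0)%:R * b.
Proof.
rewrite mxtrace_diag; under eq_bigr do rewrite mxE.
by rewrite (big_ord_if _ _ _ kn) !sumr_const_nat subn0 !mulr_natl.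
Qed.

Lemma det_scalar_dsum a b :
  \det (D a b) = a ^+ (2 * m0) * b ^+ (n - 2 * m0).
Proof.
rewrite det_diag; under eq_bigr do rewrite mxE.
by rewrite (big_ord_if _ _ _ kn) !prodr_const_nat subn0.
Qed.

End Swirl.

(** * Derivatives and bounds of matrix curves *)

Section MatrixCurves.
Context {R : realType}.

Lemma is_derive_mx (m n : nat) (A : R -> 'M[R]_(m, n)) (L : 'M[R]_(m, n)) (t : R) :
  (forall i j, is_derive t 1 (fun s => A s i j) (L i j)) -> is_derive t 1 A L.
Proof.
move=> dA; have derA : derivable A t 1.
  by apply/derivable_mxP => i j; have [] := dA i j.
apply: DeriveDef => //; rewrite derive_mx//; apply/matrixP => i j.
by rewrite mxE; have [_ ->] := dA i j.
Qed.

Lemma is_derive_scalar_dsum (n k : nat) (f g : R -> R) (a b t : R) :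
  is_derive t 1 f a -> is_derive t 1 g b ->
  is_derive t 1 (fun s => scalar_dsum n k (f s) (g s)) (scalar_dsum n k a b).
Proof.
move=> df dg; apply: is_derive_mx => i j.
rewrite (_ : (fun s => _) =
  fun s => if i == j then if (i < k)%N then f s else g s else 0); last first.
  by apply/funext => s; rewrite !mxE; case: eqP.
rewrite !mxE; case: eqP => _; last exact: is_derive_cst.
by rewrite mulr1n; case: ifP.
Qed.

Lemma hs_norm_le (n : nat) (A : 'M[R]_n) (c : R) : 0 <= c ->
  (forall i j, `|A i j| <= c) -> hs_norm A <= n%:R * c.
Proof.
move=> c0 Ac; rewrite /hs_norm -[leRHS]ger0_norm ?mulr_ge0// -sqrtr_sqr.
rewrite ler_sqrt ?sqr_ge0// exprMn /mxtrace.
have -> : n%:R ^+ 2 * c ^+ 2 = \sum_(i < n) \sum_(j < n) c ^+ 2.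
  by rewrite !sumr_const card_ord -mulrnA -[RHS]mulr_natl natrM expr2.
apply: ler_sum => i _; rewrite mxE; apply: ler_sum => j _.
rewrite mxE -expr2 -real_normK ?num_real// ler_sqr ?nnegrE//.
Qed.

Lemma hs_norm_ge (n : nat) (A : 'M[R]_n) (i j : 'I_n) : `|A i j| <= hs_norm A.
Proof.
rewrite /hs_norm -sqrtr_sqr; apply: ler_wsqrtr; rewrite /mxtrace.
have pos (l : 'I_n) : 0 <= (A *m A^T) l l.
  by rewrite mxE sumr_ge0// => k _; rewrite mxE -expr2 sqr_ge0.
rewrite (bigD1 i)//= -[leLHS]addr0 lerD ?sumr_ge0//.
rewrite mxE (bigD1 j)//= -[leLHS]addr0 lerD ?mxE -?expr2// sumr_ge0// => k _.
by rewrite mxE -expr2 sqr_ge0.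
Qed.

Lemma periodic_bounded (f : R -> R) (T : R) : 0 < T -> continuous f ->
  (forall t, f (t + T) = f t) -> exists c, forall t, `|f t| <= c.
Proof.
move=> T0 cf fT.
have fTn (k : nat) t : f (t + T *+ k) = f t by exact: periodicn.
have [|s _ smax] := @EVT_max R (fun t => `|f t|) 0 T (ltW T0).
  apply: continuous_subspaceT => t; apply: continuous_comp; first exact: cf.
  exact: norm_continuous.
exists `|f s| => t.
have [k [kt tk]] : exists k : int, T *~ k <= t /\ t <= T *~ k + T.
  exists (Num.floor (t / T)).
  have := floor_itv (t / T); rewrite intrD => /andP[lo hi]; split.
    by rewrite -mulrzl -ler_pdivlMr.
  have -> : T *~ Num.floor (t / T) + T = ((Num.floor (t / T))%:~R + 1) * T.
    by rewrite mulrDl mul1r mulrzl.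
  by rewrite -ler_pdivrMr// ltW.
have fTz (l : int) u : f (u + T *~ l) = f u.
  case: l => l; first by rewrite -pmulrn fTn.
  by rewrite NegzE -nmulrn -{2}(subrK (T *+ l.+1) u) fTn.
rewrite -(subrK (T *~ k) t) fTz; apply: smax.
by rewrite in_itv/= subr_ge0 kt lerBlDr addrC.
Qed.

Lemma bounded_curve_entries (n : nat) (A : R -> 'M[R]_n) (c : R) :
  (forall t i j, `|A t i j| <= c) -> bounded_curve A.
Proof.
move=> Ac; exists (n%:R * `|c|) => t; apply: hs_norm_le => // i j.
exact: le_trans (ler_norm _).
Qed.

Lemma bounded_curve_scalar_dsum (n k : nat) (f g : R -> R) (c d : R) :
  (forall t, `|f t| <= c) -> (forall t, `|g t| <= d) ->
  bounded_curve (fun t => scalar_dsum n k (f t) (g t)).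
Proof.
move=> fc gd; apply: (@bounded_curve_entries _ _ (Num.max c d)) => t i j.
rewrite !mxE le_max; case: (i == j); last first.
  by rewrite mulr0n normr0 (le_trans _ (fc t)).
by rewrite mulr1n; case: ifP => _; rewrite ?fc ?gd ?orbT.
Qed.

End MatrixCurves.

(** * Reduction of the geodesic system to one degree of freedom *)

(** Read A = e^(2x), B = e^(- kap x), k = x', dk = x'': the left sides are the derivatives of the
    two scalars 2 k A and - kap k B of omega. The multiplier [lam] preserves tr(beta omega) = 0,
    which makes both equations agree on one [dk]. *)
Lemma reduced_geodesic_equation {R : realType} (P Q A B z y k dk : R) :
  0 < P -> 0 < Q -> 0 < A -> 0 < B ->
  let kap := 2 * P / Q in
  let lam := 2^-1 * ((P * ((2 * k * A) ^+ 2 - z ^+ 2) / A ^+ 2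
                      + Q * ((kap * k * B) ^+ 2 - y ^+ 2) / B ^+ 2)
                     / (P / A + Q / B)) in
  dk = - ((2 * P * A - Q * kap ^+ 3 / 4 * B) * k ^+ 2
          + (- (P * z ^+ 2 / 2) / A + Q * kap * y ^+ 2 / 4 / B))
       / (2 * (P * A + Q * kap ^+ 2 / 4 * B)) ->
  2 * dk * A + 4 * k ^+ 2 * A = 2^-1 * (((2 * k * A) ^+ 2 + z ^+ 2) / A) + lam /\
  - kap * dk * B + kap ^+ 2 * k ^+ 2 * B
    = 2^-1 * (((kap * k * B) ^+ 2 + y ^+ 2) / B) + lam.
Proof.
move=> P0 Q0 A0 B0 kap lam ->; rewrite /lam /kap.
(* [n1] is the numerator of P / A + Q / B, and [n2] that of the inertia once kap is inserted. *)
have n1 : P * B + Q * A != 0 by rewrite gt_eqF// addr_gt0// mulr_gt0.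
have n2 : P * A * Q + P ^+ 2 * B != 0.
  by rewrite gt_eqF// addr_gt0// mulr_gt0// ?exprn_gt0// mulr_gt0.
by split; field; rewrite n1 n2 !gt_eqF.
Qed.

(** With L = ln beta0, these match the exponents and rates of the prescribed data with the reduced
    curves at x = - L / (2 P), x' = v / (2 P). *)
Lemma log_rates {F : numFieldType} (P Q L v : F) : P != 0 -> Q != 0 ->
  let kap := 2 * P / Q in
  [/\ - 2 * (- L / (2 * P)) = P^-1 * L, 2 * (- L / (2 * P)) = - P^-1 * L,
      kap * (- L / (2 * P)) = - Q^-1 * L, - kap * (- L / (2 * P)) = Q^-1 * L
    & 2 * (v / (2 * P)) = P^-1 * v /\ kap * (v / (2 * P)) = Q^-1 * v].
Proof. by move=> P0 Q0; split; [..|split]; field; rewrite ?P0 ?Q0. Qed.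

Section SwirlingFlows.
Context {R : realType}.
Variables (m m0 : nat).
Hypotheses (m0_gt0 : (0 < m0)%N) (m0m : (m0 < m)%N).
Local Notation n := (2 * m)%N.
Local Notation D := (@scalar_dsum R n (2 * m0)).
Local Notation J := (@swirlmx R m).
Let P : R := (2 * m0)%:R.
Let Q : R := (n - 2 * m0)%:R.
Let kap : R := 2 * P / Q.

Let m0m' : (m0 <= m)%N. Proof. exact: ltnW. Qed.
Let P0 : 0 < P. Proof. by rewrite ltr0n muln_gt0. Qed.
Let Q0 : 0 < Q. Proof. by rewrite ltr0n subn_gt0 ltn_mul2l. Qed.
Let kap0 : 0 < kap. Proof. by rewrite divr_gt0// mulr_gt0. Qed.

Lemma swirl_swirl a b c d : (D a b *m J) *m (D c d *m J) = D (- (a * c)) (- (b * d)).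
Proof.
rewrite mulmxA -[D a b *m J *m D c d]mulmxA swirlmxC.
rewrite [D a b *m _]mulmxA scalar_dsumM -mulmxA swirlmx_sqr.
by rewrite mulmxN mulmx1 scalar_dsumN.
Qed.

Lemma swirl_dsumr a b c d : (D a b *m J) *m D c d = D (a * c) (b * d) *m J.
Proof. by rewrite -mulmxA swirlmxC mulmxA scalar_dsumM. Qed.

Lemma dsum_swirl a b c d : D a b *m (D c d *m J) = D (a * c) (b * d) *m J.
Proof. by rewrite mulmxA scalar_dsumM. Qed.

Lemma swirlT a b : (D a b *m J)^T = - (D a b *m J).
Proof. by rewrite trmx_mul scalar_dsumT swirlmxT mulNmx swirlmxC. Qed.

(** Cross terms of the quadratic form cancel, leaving w^2 + z^2. In the traces zeta enters without
    transposition, so J^2 = -1 turns the sign: w^2 - z^2. *)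
Lemma omega_rhs_swirl b1 b2 w1 w2 z y :
  let lam := 2^-1 * ((P * (w1 ^+ 2 - z ^+ 2) * b1 ^+ 2
                      + Q * (w2 ^+ 2 - y ^+ 2) * b2 ^+ 2) / (P * b1 + Q * b2)) in
  omega_rhs (D b1 b2) (D w1 w2) (D z y *m J) =
  D (2^-1 * ((w1 ^+ 2 + z ^+ 2) * b1) + lam)
    (2^-1 * ((w2 ^+ 2 + y ^+ 2) * b2) + lam).
Proof.
move=> lam; rewrite /omega_rhs.
have -> : (D w1 w2 + D z y *m J)^T *m D b1 b2 *m (D w1 w2 + D z y *m J) =
    D ((w1 ^+ 2 + z ^+ 2) * b1) ((w2 ^+ 2 + y ^+ 2) * b2).
  rewrite [(_ + _)^T]linearD /= scalar_dsumT swirlT mulmxBl scalar_dsumM swirl_dsumr.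
  rewrite mulmxDr !mulmxBl scalar_dsumM dsum_swirl swirl_dsumr swirl_swirl.
  have -> : D (w1 * b1 * z) (w2 * b2 * y) = D (z * b1 * w1) (y * b2 * w2).
    by congr scalar_dsum; ring.
  rewrite addrA subrK scalar_dsumN scalar_dsumD.
  by congr scalar_dsum; ring.
rewrite !scalar_dsumM !swirl_dsumr swirl_swirl scalar_dsumM !tr_scalar_dsum//.
rewrite !(scalar_dsum_cst m m0) scalar_dsumZ !scalar_dsumD.
by congr (scalar_dsum _ _ _ _); rewrite -addrA -mulrDr -mulrDl /lam;
   congr (_ + 2^-1 * (_ / _)); rewrite -/P -/Q; ring.
Qed.

Lemma admissible_swirl b1 b2 w1 w2 z y : 0 < b1 -> 0 < b2 ->
  b1 ^+ (2 * m0) * b2 ^+ (n - 2 * m0) = 1 -> P * (b1 * w1) + Q * (b2 * w2) = 0 ->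
  admissible (D b1 b2) (D w1 w2) (D z y *m J).
Proof.
move=> b10 b20 det1 tr0; split.
- exact: posdef_scalar_dsum.
- by rewrite det_scalar_dsum.
- exact: scalar_dsumT.
- exact: swirlT.
- by rewrite scalar_dsumM tr_scalar_dsum.
Qed.

Definition beta_curve (x : R -> R) (t : R) : 'M[R]_n :=
  D (expR (- 2 * x t)) (expR (kap * x t)).

(** Forced by beta' = - beta omega beta with k = x'. *)
Definition omega_curve (x k : R -> R) (t : R) : 'M[R]_n :=
  D (2 * k t * expR (2 * x t)) (- (kap * k t * expR (- kap * x t))).

(** Both scalar constraints reduce to kap Q = 2 P: it cancels the exponents in the determinant and
    the two terms of tr(beta omega). *)
Lemma admissible_curve (x k : R -> R) z y t :
  admissible (beta_curve x t) (omega_curve x k t) (D z y *m J).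
Proof.
apply: admissible_swirl; rewrite ?expR_gt0//.
  rewrite -!expRM_natl -expRD -[RHS]expR0; congr expR.
  rewrite -/P -/Q /kap; field.
  by rewrite gt_eqF.
have e1 : expR (- 2 * x t) * expR (2 * x t) = 1.
  by rewrite -expRD mulNr addNr expR0.
have e2 : expR (kap * x t) * expR (- kap * x t) = 1.
  by rewrite -expRD mulNr addrN expR0.
have cancel (u e E : R) : e * E = 1 -> e * (u * E) = u.
  by move=> h; rewrite mulrCA h mulr1.
rewrite (cancel _ _ _ e1) mulrN (cancel _ _ _ e2) /kap.
by field; rewrite gt_eqF.
Qed.

Lemma geodesic_of_motion (x k : R -> R) z y :
  conservative_motion (inertia P Q kap) (dinertia P Q kap)
    (dpotential P Q kap z y) x k ->
  geodesic_solution (beta_curve x) (omega_curve x k) (fun=> D z y *m J).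
Proof.
move=> xk t; have [dx dk] := xk t.
have dexp a : is_derive t 1 (fun s => expR (a * x s)) (a * k t * expR (a * x t)).
  have := @is_derive1_comp R (fun u => expR (a * u)) x t _ _
    (is_derive_expRM a (x t)) dx.
  by rewrite mulrAC.
set A := expR (2 * x t); set B := expR (- kap * x t).
have A0 : 0 < A by exact: expR_gt0.
have B0 : 0 < B by exact: expR_gt0.
have AV : expR (- 2 * x t) = A^-1 by rewrite -expRN mulNr.
have BV : expR (kap * x t) = B^-1 by rewrite -expRN -mulNr opprK.
split.
- exact: admissible_curve.
- have -> : beta_rhs (beta_curve x t) (omega_curve x k t) =
      D (- 2 * k t * expR (- 2 * x t)) (kap * k t * expR (kap * x t)).
    rewrite /beta_rhs !scalar_dsumM scalar_dsumN AV BV -/A -/B.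
    by congr (scalar_dsum _ _ _ _); field; rewrite gt_eqF.
  apply: is_derive_scalar_dsum; exact: dexp.
- set dk' := - _ / _ in dk.
  have dk'E : dk' = - ((2 * P * A - Q * kap ^+ 3 / 4 * B) * k t ^+ 2
      + (- (P * z ^+ 2 / 2) / A + Q * kap * y ^+ 2 / 4 / B))
      / (2 * (P * A + Q * kap ^+ 2 / 4 * B)).
    by rewrite /dk' /dinertia /dpotential /inertia AV BV.
  have [e1 e2] := reduced_geodesic_equation P0 Q0 A0 B0 dk'E.
  have -> : omega_rhs (beta_curve x t) (omega_curve x k t) (D z y *m J) =
      D (2 * dk' * A + 4 * k t ^+ 2 * A)
        (- kap * dk' * B + kap ^+ 2 * k t ^+ 2 * B).
    by rewrite omega_rhs_swirl AV BV -/A -/B e1 e2 sqrrN !exprVn.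
  have d1 := dexp 2; have d2 := dexp (- kap).
  apply: is_derive_scalar_dsum.
    apply: is_derive_eq; rewrite /GRing.scale/= -/A; ring.
  apply: is_derive_eq; rewrite /GRing.scale/= -/B; ring.
- exact: is_derive_cst.
Qed.

Lemma geodesic_initial_data (beta0 v : R) (x k : R -> R) : 0 < beta0 ->
  x 0 = - ln beta0 / (2 * P) -> k 0 = v / (2 * P) ->
  beta_curve x 0 = beta_init n m0 beta0 /\
  omega_curve x k 0 = omega_init n m0 beta0 v.
Proof.
move=> b0 x0 k0; rewrite /beta_curve /omega_curve /beta_init /omega_init x0 k0.
rewrite /powR (gt_eqF b0) -/P -/Q.
have [-> -> -> -> [-> ->]] := log_rates (ln beta0) v (lt0r_neq0 P0) (lt0r_neq0 Q0).
by [].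
Qed.

Lemma beta_curve_unbounded (x : R -> R) : (forall B, exists t, B <= x t) ->
  ~ bounded_curve (beta_curve x).
Proof.
move=> xs [B xB]; have [t Bt] := xs (B / kap).
(* As m0 < m, the last diagonal entry lies in the shear block, where it is e^(kap x) >= 1 + kap
   x. *)
have n0 : (n.-1 < n)%N by rewrite ltn_predL muln_gt0/= (leq_ltn_trans _ m0m).
have := le_trans (hs_norm_ge (beta_curve x t) (Ordinal n0) (Ordinal n0)) (xB t).
have lt : (n.-1 < 2 * m0)%N = false by lia.
rewrite !mxE eqxx mulr1n lt gtr0_norm ?expR_gt0// leNgt => /negP; apply.
apply: lt_le_trans (expR_ge1Dx _); rewrite -ltrBlDl (lt_le_trans (y := B))//.
  by rewrite ltrBlDr ltrDl.
by rewrite mulrC -ler_pdivrMr.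
Qed.

Lemma invmx_beta_curve (x : R -> R) t :
  invmx (beta_curve x t) = D (expR (2 * x t)) (expR (- kap * x t)).
Proof.
have e : beta_curve x t *m D (expR (2 * x t)) (expR (- kap * x t)) = 1%:M.
  by rewrite scalar_dsumM -!expRD !mulNr addNr addrN !expR0 (scalar_dsum_cst m m0).
have [u _] := mulmx1_unit e.
by rewrite -[LHS]mulmx1 -e mulmxA mulVmx// mul1mx.
Qed.

Lemma periodic_motion_bounded (x k : R -> R) (T : R) : 0 < T ->
  continuous x -> continuous k -> (forall t, x (t + T) = x t /\ k (t + T) = k t) ->
  [/\ bounded_curve (beta_curve x), bounded_curve (omega_curve x k)
    & bounded_curve (fun t => invmx (beta_curve x t))].
Proof.
move=> T0 cx ck per.
have cexp a : continuous (fun t => expR (a * x t)).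
  move=> t; apply: continuous_comp; last exact: continuous_expR.
  by apply: cvgMr; exact: cx.
have bexp a : exists c, forall t, `|expR (a * x t)| <= c.
  by apply: (periodic_bounded T0 (cexp a)) => t; have [-> _] := per t.
have bkexp a b : exists c, forall t, `|a * k t * expR (b * x t)| <= c.
  apply: (periodic_bounded T0).
    by move=> t; apply: cvgM; [apply: cvgMr; exact: ck | exact: cexp].
  by move=> t; have [-> ->] := per t.
have [c1 h1] := bexp (- 2); have [c2 h2] := bexp kap.
have [c3 h3] := bexp 2; have [c4 h4] := bexp (- kap).
have [c5 h5] := bkexp 2 2; have [c6 h6] := bkexp kap (- kap).
split.
- exact: bounded_curve_scalar_dsum h1 h2.
- apply: (@bounded_curve_scalar_dsum R _ _ _ _ c5 c6) => // t.
  by rewrite normrN.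
- have [c bc] := bounded_curve_scalar_dsum n (2 * m0) h3 h4.
  by exists c => t; rewrite invmx_beta_curve.
Qed.

Lemma swirl_dist (b w : 'M[R]_n) z z' y : 
  data_dist b w (D z y *m J) b w (swirl_dsum n m0 z')
  <= n%:R * Num.max `|z - z'| `|y|.
Proof.
have h0 : hs_norm (0 : 'M[R]_n) = 0 by rewrite /hs_norm mul0mx mxtrace0 sqrtr0.
rewrite /data_dist !subrr h0 !add0r swirl_dsumE -mulmxBl scalar_dsumN scalar_dsumD oppr0 addr0.
apply: hs_norm_le => [|i j]; first by rewrite le_max normr_ge0.
rewrite mul_diag_mx mxE normrM -[leRHS]mulr1.
apply: ler_pM; rewrite ?normr_ge0//; last exact: (@swirlmx_le1 R m i j).
by rewrite mxE; case: ifP => _; rewrite le_max lexx ?orbT.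
Qed.

End SwirlingFlows.

(** * Escape of the given flow and periodicity of its perturbations *)

Theorem mainTheorem12 (R : realType) (n m m0 : nat) (beta0 z0 v : R)
    (hn : n = (2 * m)%N) (hn4 : (4 <= n)%N)
    (hm0 : (1 <= m0)%N) (hm0m : (m0 < m)%N)
    (hbeta0 : 0 < beta0) (hz0v : (z0, v) <> (0, 0)) :
  (exists beta omega zeta : R -> 'M[R]_n,
    [/\ geodesic_solution beta omega zeta,
        beta 0 = beta_init n m0 beta0,
        omega 0 = omega_init n m0 beta0 v,
        zeta 0 = swirl_dsum n m0 z0
      & ~ bounded_curve beta])
  /\
  (forall eps : R, 0 < eps ->
    exists b w z : 'M[R]_n,
      [/\ admissible b w z,
          data_dist b w z (beta_init n m0 beta0) (omega_init n m0 beta0 v)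
            (swirl_dsum n m0 z0) < eps
        & exists beta omega zeta : R -> 'M[R]_n,
            [/\ geodesic_solution beta omega zeta,
                [/\ beta 0 = b, omega 0 = w & zeta 0 = z],
                [/\ bounded_curve beta, bounded_curve omega
                  & bounded_curve zeta],
                bounded_curve (fun t => invmx (beta t))
              & periodic_solution beta omega zeta]]).
Proof.
subst n; rename hm0m into lt_m0m.
have lt2 : (2 * m0 < 2 * m)%N by rewrite ltn_mul2l.
have P0 : (0 : R) < (2 * m0)%:R by rewrite ltr0n muln_gt0.
have Q0 : (0 : R) < (2 * m - 2 * m0)%:R by rewrite ltr0n subn_gt0.
set P : R := (2 * m0)%:R in P0; set Q : R := (2 * m - 2 * m0)%:R in Q0.
pose kap : R := 2 * P / Q.
have kap0 : 0 < kap by rewrite divr_gt0// mulr_gt0.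
pose x0 : R := - ln beta0 / (2 * P); pose k0 : R := v / (2 * P).
split.
- have [x [k [xk x00 k00 xs]]] : exists x k : R -> R,
      [/\ conservative_motion (inertia P Q kap) (dinertia P Q kap)
            (dpotential P Q kap z0 0) x k, x 0 = x0, k 0 = k0
        & forall B, exists t, B <= x t].
    (* If z0 vanishes then v does not, so the free motion starts with nonzero velocity. *)
    have [z00|z00] := eqVneq z0 0; last exact: repelled_motion_escapes.
    rewrite z00; apply: free_motion_escapes => //.
    apply: mulf_neq0; last by rewrite invr_eq0 gt_eqF// mulr_gt0.
    by apply/eqP => v0; apply: hz0v; rewrite z00 v0.
  have [b0 w0] := geodesic_initial_data hm0 lt_m0m hbeta0 x00 k00.
  exists (beta_curve m m0 x), (omega_curve m m0 x k),
    (fun=> scalar_dsum (2 * m) (2 * m0) z0 0 *m swirlmx m).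
  split=> //; first exact: geodesic_of_motion.
  + by rewrite swirl_dsumE.
  + exact: beta_curve_unbounded.
- move=> eps eps0.
  (* The denominator 2 m + 1 keeps 2 m times [del], which bounds the distance, strictly below
     [eps]. *)
  pose del := eps / (2 * m).+1%:R.
  have del0 : 0 < del by rewrite divr_gt0// ltr0n.
  pose z := if z0 == 0 then del else z0.
  have z_neq0 : z != 0 by rewrite /z; case: (eqVneq z0 0) => [_|//]; rewrite gt_eqF.
  have zz0 : `|z - z0| <= del.
    rewrite /z; case: (eqVneq z0 0) => [->|_]; first by rewrite subr0 gtr0_norm.
    by rewrite subrr normr0 ltW.
  (* The shear block rotates at rate [del]; x(0) and x'(0) are kept, so beta(0) and omega(0) are
     unperturbed. *)
  have [x [k [xk x00 k00 [T T0 xkT]]]] :=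
    @oscillating_motion R P Q kap P0 Q0 kap0 z del x0 k0 z_neq0 (lt0r_neq0 del0).
  have [b0 w0] := geodesic_initial_data hm0 lt_m0m hbeta0 x00 k00.
  pose zeta : 'M[R]_(2 * m) := scalar_dsum (2 * m) (2 * m0) z del *m swirlmx m.
  exists (beta_init (2 * m) m0 beta0), (omega_init (2 * m) m0 beta0 v), zeta; split.
  + rewrite -b0 -w0; exact: admissible_curve.
  + apply: le_lt_trans (swirl_dist _ _ _ _ _ _) _.
    apply: (@le_lt_trans _ _ ((2 * m)%:R * del)).
      by rewrite ler_wpM2l// ge_max zz0 gtr0_norm/=.
    by rewrite /del mulrA ltr_pdivrMr ?ltr0n// mulrC ltr_pM2l// ltr_nat.
  + exists (beta_curve m m0 x), (omega_curve m m0 x k), (fun=> zeta).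
    have cx : continuous x.
      by move=> t; apply: is_derive_continuous (proj1 (xk t)).
    have ck : continuous k.
      by move=> t; apply: is_derive_continuous (proj2 (xk t)).
    have [bb bw bV] := periodic_motion_bounded m m0 T0 cx ck xkT.
    split=> //.
    * exact: geodesic_of_motion.
    * by split=> //; exists (hs_norm zeta).
    * exists T => // t; have [xT kT] := xkT t.
      by rewrite /beta_curve /omega_curve xT kT.
Qed.
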